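(* Let $\mathcal{S}=\{S_1,\dots,S_m\}$ be a de Bruijn family of order $\ell$ on some alphabet $\mathcal{O}$, consisting of $m$ cyclic strings, each of length $r$. Let $\Pi=\{\pi_0,\dots,\pi_{r-1}\}$ be the set of rotations of strings of length $r$. Let $D$ be an alternating de Bruijn sequence of order $2n+1$ on the alphabet pair $(\mathcal{S},\Pi)$. Suppose that at least one of the following three conditions is satisfied, so that $\sigma(D)$ is a torus: (i) $|\mathcal{S}|$ is even; (ii) $|\Pi|$ is odd; (iii) $n\ge 2$. Let $w=n+1$ and let $v=\frac{|D|}{2}$ be half the length of $D$. Then the torus $\sigma(D)$ is a de Bruijn torus on a $v\times r$ array with window size $w\times \ell$ and alphabet $\mathcal{O}$.
   Context: Alphabets are nonempty finite sets; $\ell$ is a positive integer and $n$ is a nonnegative integer. de Bruijn family of order $\ell$ on $\mathcal{O}$: a collection of $m$ cyclic strings $S_1,\dots,S_m$ over $\mathcal{O}$, each of length $r$, such that every string of length $\ell$ over $\mathcal{O}$ appears exactly once as a (cyclic) substring, i.e. for exactly one pair (string $S_i$, starting position in $\mathbb{Z}/r$), positions being read cyclically mod $r$. For each $S_i$ a fixed representative $s_0s_1\cdots s_{r-1}$ is chosen. Rotations: for an integer $x$ and $S=s_0s_1\cdots s_{r-1}$, $\pi_x(S)=s_xs_{x+1}\cdots s_{x+r-1}$ with subscripts mod $r$. As an alphabet, $\mathcal{S}$ has $|\mathcal{S}|=m$ letters $S_1,\dots,S_m$ and $\Pi$ has $|\Pi|=r$ letters $\pi_0,\dots,\pi_{r-1}$.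 Alternating words and sequences: for finite alphabets $\mathcal{A},\mathcal{B}$, an alternating word of length $2n+1$ on $(\mathcal{A},\mathcal{B})$ is an element of $\mathcal{A}\times\mathcal{B}\times\mathcal{A}\times\cdots\times\mathcal{B}\times\mathcal{A}$ ($n+1$ factors $\mathcal{A}$, $n$ factors $\mathcal{B}$; for $n=0$ these are the letters of $\mathcal{A}$). An alternating de Bruijn sequence of order $2n+1$ on $(\mathcal{A},\mathcal{B})$ is a cyclic string $x_1y_1x_2y_2\cdots x_vy_v$ with $x_i\in\mathcal{A}$, $y_i\in\mathcal{B}$ (indices mod $v$) such that every alternating word of length $2n+1$ equals $x_iy_ix_{i+1}\cdots y_{i+n-1}x_{i+n}$ for exactly one $i\in\mathbb{Z}/v$. Its length is $2v=2|\mathcal{A}|^{n+1}|\mathcal{B}|^{n}$. The array $\sigma(D)$: write $D=S_{m_1}\pi_{r_1}S_{m_2}\pi_{r_2}\cdots S_{m_v}\pi_{r_v}$ (starting from some letter of $\mathcal{S}$), and append $S_{m_{v+1}}:=S_{m_1}$. Then $\sigma(D)$ is the $(v+1)\times r$ array over $\mathcal{O}$ whose $j$-th row is $\pi_{r_1+r_2+\cdots+r_{j-1}}(S_{m_j})$, $1\le j\le v+1$ (the first row is $S_{m_1}$). When the first and last rows coincide, $\sigma(D)$ is regarded as a $v\times r$ torus by identifying these rows, i.e. as the $v\times r$ array of its first $v$ rows, with rows and columns indexed cyclically. de Bruijn torus: a $v\times r$ array over $\mathcal{O}$, with rows and columns considered cyclically, is a de Bruijn torus of window size $w\times\ell$ if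 every $w\times \ell$ array ($w$ rows, $\ell$ columns) over $\mathcal{O}$ appears exactly once as a contiguous subarray, i.e. at exactly one position in $\mathbb{Z}/v\times\mathbb{Z}/r$.
   Formalization: That the first and last rows of σ(D) coincide is asserted only for n ≥ 1, since it can fail for n = 0 (S₁=ab, S₂=cd, D=S₁π₀S₂π₁); the window property is asserted for every n ≥ 0, for the array of the first v rows. *)

(* Defs.v *)
From mathcomp Require Import all_boot all_order all_algebra.

Set Implicit Arguments.
Unset Strict Implicit.
Unset Printing Implicit Defensive.

Definition cyc_idx (v : nat) (v_gt0 : 0 < v) (k : nat) : 'I_v :=
  Ordinal (ltn_pmod k v_gt0).

Definition cyc_add (v : nat) (i : 'I_v) (k : nat) : 'I_v :=
  cyc_idx (leq_ltn_trans (leq0n i) (ltn_ord i)) (i + k).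

Definition rotation (O : Type) (r : nat) (x : nat) (s : r.-tuple O) :
  r.-tuple O := [tuple tnth s (cyc_add c x) | c < r].

(* l may exceed r, in which case the string is read several times around. *)
Definition cyc_substring (O : Type) (r l : nat) (s : r.-tuple O) (p : 'I_r) :
  l.-tuple O := [tuple tnth s (cyc_add p k) | k < l].

Definition de_bruijn_family (O : finType) (l m r : nat)
    (S : 'I_m -> r.-tuple O) : Prop :=
  forall u : l.-tuple O,
    exists! p : 'I_m * 'I_r, cyc_substring l (S p.1) p.2 = u.

(* An alternating word a_0 b_0 a_1 ... b_(n-1) a_n, stored as the pair of
   its A-letters and its B-letters. *)
Definition alt_word (A B : Type) (n : nat) : Type :=
  (n.+1.-tuple A * n.-tuple B)%type.

(* A cyclic string x_1 y_1 ... x_v y_v of length 2v, cut before an A-letter,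
   is stored as the v.-tuple of the pairs (x_i, y_i). *)
Definition alt_subword (A B : Type) (v n : nat) (D : v.-tuple (A * B))
    (i : 'I_v) : alt_word A B n :=
  ([tuple (tnth D (cyc_add i k)).1 | k < n.+1],
   [tuple (tnth D (cyc_add i k)).2 | k < n]).

(* Of order 2n+1. *)
Definition alt_de_bruijn_seq (A B : finType) (n v : nat)
    (D : v.-tuple (A * B)) : Prop :=
  forall u : alt_word A B n, exists! i : 'I_v, alt_subword n D i = u.

(* The letter i : 'I_m stands for the string S i and the letter x : 'I_r for
   the rotation by x. Rows are numbered from 0; row v reuses the string of
   row 0, hence the index j mod v. *)
Definition sigma (O : Type) (m r v : nat) (S : 'I_m -> r.-tuple O)
    (v_gt0 : 0 < v) (D : v.-tuple ('I_m * 'I_r)) : 'M[O]_(v.+1, r) :=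
  \matrix_(j < v.+1, c < r)
    tnth (rotation (\sum_(i < v | i < j) (tnth D i).2)
                   (S (tnth D (cyc_idx v_gt0 j)).1)) c.

(* Drops the last row. The result is the torus obtained by gluing the first
   and last rows only when these agree, which can fail for order 1: there the
   rotations occurring in D are unconstrained. *)
Definition identify_ends (O : Type) (v r : nat) (M : 'M[O]_(v.+1, r)) :
  'M[O]_(v, r) := rowsub (widen_ord (leqnSn v)) M.

Definition window (O : Type) (v r w l : nat) (T : 'M[O]_(v, r))
    (p : 'I_v * 'I_r) : 'M[O]_(w, l) :=
  \matrix_(a < w, b < l) T (cyc_add p.1 a) (cyc_add p.2 b).

Definition de_bruijn_torus (O : finType) (w l v r : nat)
    (T : 'M[O]_(v, r)) : Prop :=
  forall W : 'M[O]_(w, l), exists! p : 'I_v * 'I_r, window w l T p = W.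

(* Main.v *)
(** The [c]-th column of [sigma D] reads, in row [j], the string [S_(m_j)] from
    position [c + P j], where [P j] is the sum of the first [j] rotations.
    A window therefore prescribes, through the de Bruijn family, the strings
    [S_(m_j)] and the positions [c + P j] for [n + 1] consecutive rows.
    Differences of consecutive positions are the rotations themselves, so this
    is the same as prescribing an alternating word of length [2n + 1], which
    fixes the row, and then one position in the first row, which fixes the
    column.  For [n = 0] windows have one row and never wrap around vertically;
    for [n > 0] every rotation occurs equally often in [D], so
    [P v = m ^ (n + 1) * r ^ (n - 1) * 'C(r, 2)] is divisible by [r] and [P] is
    periodic modulo [r]. *)
Require Import Defs.
From mathcomp Require Import all_boot all_order all_algebra.

Set Implicit Arguments.
Unset Strict Implicit.
Unset Printing Implicit Defensive.

(** Finiteness of [U] allows choosing the preimages without an axiom; the bijection serves to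
    reindex sums. *)
Lemma unique_preimage_bij (T : Type) (U : finType) (f : T -> U) :
  (forall u, exists! x, f x = u) -> bijective f.
Proof.
move=> f_uniq; have [|g gP] := @fin_all_exists _ _ (fun u x => f x = u).
  by move=> u; have [x [fx _]] := f_uniq u; exists x.
exists g => [x|u]; last exact: gP.
by have [y [_ y_uniq]] := f_uniq (f x); rewrite -(y_uniq _ (gP _)) (y_uniq x).
Qed.

Lemma cyc_addE (v : nat) (v_gt0 : 0 < v) (i : 'I_v) (k : nat) :
  cyc_add i k = cyc_idx v_gt0 (i + k).
Proof. exact: val_inj. Qed.

Lemma cyc_idx_ord (v : nat) (v_gt0 : 0 < v) (i : 'I_v) : cyc_idx v_gt0 i = i.
Proof. by apply: val_inj; rewrite /= modn_small. Qed.

Lemma eq_cyc_idx (v : nat) (v_gt0 : 0 < v) (j k : nat) :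
  j = k %[mod v] -> cyc_idx v_gt0 j = cyc_idx v_gt0 k.
Proof. by move=> jk; apply: val_inj. Qed.

Lemma cyc_idx_mod (v : nat) (v_gt0 : 0 < v) (k : nat) :
  cyc_idx v_gt0 (k %% v) = cyc_idx v_gt0 k.
Proof. by apply: eq_cyc_idx; rewrite modn_mod. Qed.

(** Reducing [k] first keeps the truncated subtraction exact, so this is subtraction in Z/v for
    every [k]. *)
Definition cyc_sub (v : nat) (i : 'I_v) (k : nat) : 'I_v :=
  cyc_add i (v - k %% v).

Lemma cyc_add_eq (v : nat) (i j : 'I_v) (k : nat) :
  cyc_add i k = j <-> i = cyc_sub j k.
Proof.
have v_gt0 : 0 < v := leq_ltn_trans (leq0n i) (ltn_ord i).
have le_kv : k %% v <= v by rewrite ltnW ?ltn_pmod.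
split=> [<-|->]; apply: val_inj; rewrite /= modnDml.
  by rewrite addnAC -modnDmr -addnA subnK // modnDr modn_small.
by rewrite -modnDmr -addnA subnK // modnDr modn_small.
Qed.

(** Each letter heads [r ^ n] tuples, and the letters 0, ..., r - 1 add up to ['C(r, 2)]. *)
Lemma sum_thead_tuple (r n : nat) :
  \sum_(t : n.+1.-tuple 'I_r) thead t = r ^ n * 'C(r, 2).
Proof.
rewrite (reindex (fun p : n.-tuple 'I_r * 'I_r => cons_tuple p.2 p.1)) /=.
  rewrite (eq_bigr (fun p : n.-tuple 'I_r * 'I_r => p.2 : nat)); last first.
    by move=> p _; rewrite theadE.
  rewrite -(pair_bigA _ (fun _ (b : 'I_r) => b : nat)) /=.
  by rewrite sum_nat_const card_tuple card_ord -bin2_sum big_mkord.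
exists (fun t => (behead_tuple t, thead t)) => [[t b] _|t _] /=.
  by rewrite theadE; congr (_, _); apply: val_inj.
by rewrite [RHS]tuple_eta; apply: val_inj.
Qed.

(** The rotation at position [i] is the first one in the subword read there, and these subwords run
    once through all alternating words. *)
Lemma alt_de_bruijn_sum (A : finType) (r n v : nat)
    (D : v.-tuple (A * 'I_r)) :
  alt_de_bruijn_seq n.+1 D ->
  \sum_(i < v) (tnth D i).2 = #|A| ^ n.+2 * (r ^ n * 'C(r, 2)).
Proof.
move=> D_dB; pose U := (n.+2.-tuple A * n.+1.-tuple 'I_r)%type.
have /onW_bij f_bij : bijective (alt_subword n.+1 D : 'I_v -> U).
  exact: unique_preimage_bij.
transitivity (\sum_(u : U) thead u.2).
  rewrite (reindex (alt_subword n.+1 D : 'I_v -> U)); last exact: f_bij.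
  apply: eq_bigr => i _; rewrite /thead tnth_mktuple.
  congr (val (tnth D _).2); apply: val_inj.
  by rewrite /= addn0 modn_small.
rewrite -(pair_bigA _ (fun (_ : n.+2.-tuple A) (t : n.+1.-tuple 'I_r) =>
  nat_of_ord (thead t))) /=.
by rewrite sum_thead_tuple sum_nat_const card_tuple.
Qed.

(** As [2 * 'C(r, 2)] is [r * (r - 1)], only a factor 2 is in doubt: an even [#|A|] supplies it, an
    odd [r] is coprime to it, and for [1 < n] the power of [r] in the sum suffices. *)
Lemma alt_de_bruijn_sum_dvd (A : finType) (r n v : nat)
    (D : v.-tuple (A * 'I_r)) :
  0 < n -> alt_de_bruijn_seq n D -> ~~ odd #|A| \/ odd r \/ 1 < n ->
  r %| \sum_(i < v) (tnth D i).2.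
Proof.
case: n => // n _ /alt_de_bruijn_sum ->.
have r_dvd : r %| 2 * 'C(r, 2).
  by rewrite -[2 * _]mul_bin_diag dvdn_mulr.
case=> [A_even|[r_odd|n_gt1]].
- rewrite expnSr mulnCA -mulnA dvdn_mull // dvdn_mull //.
  have /dvdnP[k ->] : 2 %| #|A| by rewrite dvdn2.
  by rewrite -mulnA dvdn_mull.
- by rewrite !dvdn_mull // -(@Gauss_dvdr _ 2) // coprimen2.
- by rewrite dvdn_mull // dvdn_mulr // dvdn_exp.
Qed.

Section RotationSums.

Variables (A : Type) (r v : nat) (v_gt0 : 0 < v) (D : v.-tuple (A * 'I_r)).

(** Indices wrap around, so windows crossing the last row can be described by sums past [v]. *)
Definition rotation_sum (k : nat) : nat :=
  \sum_(i < k) (tnth D (cyc_idx v_gt0 i)).2.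

Lemma rotation_sumS k :
  rotation_sum k.+1 = rotation_sum k + (tnth D (cyc_idx v_gt0 k)).2.
Proof. by rewrite /rotation_sum big_ord_recr. Qed.

Lemma rotation_sum_ord k :
  k <= v -> \sum_(i < v | i < k) (tnth D i).2 = rotation_sum k.
Proof.
move=> le_kv; rewrite (big_ord_narrow le_kv); apply: eq_bigr => i _.
by rewrite -[X in tnth D X](cyc_idx_ord v_gt0).
Qed.

Lemma rotation_sum_period k :
  rotation_sum (v + k) = rotation_sum v + rotation_sum k.
Proof.
rewrite /rotation_sum big_split_ord /=; congr (_ + _).
by apply: eq_bigr => i _; rewrite (@eq_cyc_idx _ _ (v + i) i) // modnDl.
Qed.

Lemma rotation_sum_mod k :
  r %| rotation_sum v -> rotation_sum (k %% v) = rotation_sum k %[mod r].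
Proof.
move=> r_dvd; rewrite [in RHS](divn_eq k v).
elim: (k %/ v) => [//|q IHq].
by rewrite mulSn -addnA rotation_sum_period -modnDml (eqP r_dvd).
Qed.

End RotationSums.

Section Torus.

Variables (O : Type) (m r v : nat) (S : 'I_m -> r.-tuple O) (v_gt0 : 0 < v).
Variable D : v.-tuple ('I_m * 'I_r).

Let P := rotation_sum v_gt0 D.

Lemma sigmaE (j : 'I_v.+1) (c : 'I_r) :
  sigma S v_gt0 D j c =
  tnth (S (tnth D (cyc_idx v_gt0 j)).1) (cyc_add c (P j)).
Proof.
by rewrite mxE tnth_mktuple (@rotation_sum_ord _ _ _ v_gt0 D j (leq_ord j)).
Qed.

Lemma row_sigma_ends :
  r %| P v -> row ord0 (sigma S v_gt0 D) = row ord_max (sigma S v_gt0 D).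
Proof.
move=> r_dvd; apply/rowP => c; rewrite [LHS]mxE [RHS]mxE !sigmaE.
rewrite (@eq_cyc_idx v _ (ord_max : 'I_v.+1) (ord0 : 'I_v.+1)) ?modnn ?mod0n //.
congr tnth; apply: val_inj => /=.
rewrite {1}/P /rotation_sum big_ord0 -[in RHS]modnDmr.
by move/eqP: r_dvd => ->.
Qed.

Lemma row_windowP n l (p : 'I_v * 'I_r) (a : 'I_n.+1) (u : l.-tuple O) :
  (0 < n -> r %| P v) ->
  (forall b, window n.+1 l (identify_ends (sigma S v_gt0 D)) p a b = tnth u b)
  <-> cyc_substring l (S (tnth D (cyc_add p.1 a)).1) (cyc_add p.2 (P (p.1 + a)))
      = u.
Proof.
move=> r_dvd.
have P_mod : P ((p.1 + a) %% v) = P (p.1 + a) %[mod r].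
  (* A window of one row has [a] = 0 and [p.1 < v], so nothing is reduced; taller ones use the
     period. *)
  case: n a r_dvd => [|n] a r_dvd; last exact: rotation_sum_mod (r_dvd _).
  by rewrite ord1 addn0 (modn_small (ltn_ord p.1)).
have TE b : window n.+1 l (identify_ends (sigma S v_gt0 D)) p a b =
    tnth (cyc_substring l (S (tnth D (cyc_add p.1 a)).1)
                        (cyc_add p.2 (P (p.1 + a)))) b.
  rewrite tnth_mktuple mxE mxE sigmaE /= cyc_idx_mod -cyc_addE.
  congr tnth; apply: val_inj => /=.
  by rewrite modnDml -modnDmr P_mod modnDmr modnDml addnAC.
by split=> [uE|<- //]; apply: eq_from_tnth => b; rewrite -TE uE.
Qed.

(** [q a] is the string and the starting position required in row [a]; a rotation is the step
    between successive positions. *)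
Definition word_of_rows n (q : 'I_n.+1 -> 'I_m * 'I_r) :
  alt_word 'I_m 'I_r n :=
  ([tuple (q a).1 | a < n.+1],
   [tuple cyc_sub (q (lift ord0 k)).2 (q (widen_ord (leqnSn n) k)).2 | k < n]).

Lemma word_of_rowsP n (p : 'I_v * 'I_r) (q : 'I_n.+1 -> 'I_m * 'I_r) :
  (forall a : 'I_n.+1,
     ((tnth D (cyc_add p.1 a)).1, cyc_add p.2 (P (p.1 + a))) = q a) <->
  alt_subword n D p.1 = word_of_rows q /\ p.2 = cyc_sub (q ord0).2 (P p.1).
Proof.
have PS k : P (p.1 + k.+1) = P (p.1 + k) + (tnth D (cyc_add p.1 k)).2.
  by rewrite addnS /P rotation_sumS -cyc_addE.
split=> [qE|[word col]].
  split; last by apply/cyc_add_eq; rewrite -qE /= addn0.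
  congr (_, _); apply: eq_mktuple => k; first by rewrite -qE.
  apply/cyc_add_eq; rewrite -!qE /= /bump add1n.
  by apply: val_inj; rewrite /= modnDmr addnC -addnA -PS.
case=> k lt_kn; rewrite [RHS]surjective_pairing; congr (_, _).
  have := congr1 (fun u : alt_word _ _ n => tnth u.1 (Ordinal lt_kn)) word.
  by rewrite !tnth_mktuple.
(* The column fixes the position in row 0, and each rotation of the word carries it one row down. *)
elim: k lt_kn => [|k IHk] lt_kn.
  rewrite /= addn0; apply/cyc_add_eq; rewrite col; congr (cyc_sub (q _).2 _).
  exact: val_inj.
have lt_k : k < n := lt_kn.
have := congr1 (fun u : alt_word _ _ n => tnth u.2 (Ordinal lt_k)) word.
rewrite !tnth_mktuple => /cyc_add_eq /=.
set a := lift _ _; have -> : Ordinal lt_kn = a by exact: val_inj.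
move=> <-; set b := widen_ord _ _.
have -> : b = Ordinal (ltnW lt_kn) by exact: val_inj.
by rewrite -IHk; apply: val_inj; rewrite /= modnDmr [in RHS]addnC -addnA -PS.
Qed.

End Torus.

Theorem theorem4 (O : finType) (l m r n v : nat)
  (O_gt0 : 0 < #|O|) (l_gt0 : 0 < l)
  (S : 'I_m -> r.-tuple O) (S_dB : de_bruijn_family l S)
  (v_gt0 : 0 < v) (D : v.-tuple ('I_m * 'I_r))
  (D_dB : alt_de_bruijn_seq n D)
  (hcond : ~~ odd #|'I_m| \/ odd #|'I_r| \/ 2 <= n) :
  (0 < n -> row ord0 (sigma S v_gt0 D) = row ord_max (sigma S v_gt0 D)) /\
  de_bruijn_torus n.+1 l (identify_ends (sigma S v_gt0 D)).
Proof.
have r_dvd : 0 < n -> r %| rotation_sum v_gt0 D v.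
  move=> n_gt0; rewrite -rotation_sum_ord //.
  rewrite (eq_bigl xpredT) => [|i]; last exact: ltn_ord.
  by rewrite (card_ord r) in hcond; exact: alt_de_bruijn_sum_dvd hcond.
split=> [/r_dvd|W]; first exact: row_sigma_ends.
(* By the family property each row of [W] occurs at a single place [q a]. *)
have /fin_all_exists[q qE] (a : 'I_n.+1) : exists q, forall p,
    cyc_substring l (S p.1) p.2 = [tuple W a b | b < l] <-> p = q.
  have [q [qE q_uniq]] := S_dB [tuple W a b | b < l].
  by exists q => p; split=> [/q_uniq|->].
have windowP p : window n.+1 l (identify_ends (sigma S v_gt0 D)) p = W <->
    alt_subword n D p.1 = word_of_rows q /\
    p.2 = cyc_sub (q ord0).2 (rotation_sum v_gt0 D p.1).
  split=> [winE|/word_of_rowsP winE].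
    apply/word_of_rowsP => a; apply/(qE a)/row_windowP => // b.
    by rewrite winE tnth_mktuple.
  apply/matrixP => a b.
  by have /qE/row_windowP -> := winE a; rewrite ?tnth_mktuple.
have [i [iE i_uniq]] := D_dB (word_of_rows q).
(* The column undoes the shift that row [i] has accumulated. *)
exists (i, cyc_sub (q ord0).2 (rotation_sum v_gt0 D i)).
split=> [|[i' c] /windowP[/i_uniq /= <- ->] //].
exact/windowP.
Qed.
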